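(* Let the boundary conditions be of the form $y(0)=Ay(1)$, where $A\in\mathbb C^{n\times n}$, $\det A\neq0$, $AB+BA=0$, and suppose that for some $\varepsilon>0$ $$Q(1-x)=A^{-1}Q(x)A,\qquad x\in[0,\varepsilon].$$ Then the defect of the system of root functions of the operator $L_{C,D}(Q)$ (with $C=I_n$, $D=-A$) in $L^2([0,1];\mathbb C^n)$ is infinite.
   Context: Let $B=\operatorname{diag}(b_1,\dots,b_n)\in\mathbb C^{n\times n}$ be nonsingular and $Q\in L^1([0,1];\mathbb C^{n\times n})$. The operator $L_{C,D}(Q)$ acts in $L^2([0,1];\mathbb C^n)$ by $y\mapsto -iB^{-1}y'+Q(x)y$ on the domain $\{y\in W^{1,1}([0,1];\mathbb C^n): -iB^{-1}y'+Qy\in L^2([0,1];\mathbb C^n),\ Cy(0)+Dy(1)=0\}$. System of root functions: union over all eigenvalues $\lambda$ of bases (eigenfunctions and associated functions) of the root subspaces $\bigcup_m\ker(L_{C,D}(Q)-\lambda)^m$. The defect of a system is the dimension of the orthogonal complement of its linear span. *)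

(* Defs.v *)
From HB Require Import structures.
From mathcomp Require Import all_boot all_order all_algebra.
From mathcomp Require Import all_classical all_reals all_analysis.
From mathcomp Require Import complex.
Set Implicit Arguments.
Unset Strict Implicit.
Unset Printing Implicit Defensive.
Import Order.TTheory GRing.Theory Num.Theory.

Local Open Scope classical_set_scope.
Local Open Scope ring_scope.

(* Functions on [0, 1] are represented by total functions on R whose values
   outside [0, 1] are irrelevant; elements of L^p are represented by Borel
   functions, compared almost everywhere on [0, 1] with [aeq]. *)

Section FunctionSpaces.
Context {R : realType}.
Local Notation C := R[i].
Local Notation mu := (@lebesgue_measure R).

Definition unit_itv : set R := `[0, 1].

(* The C^(m x n)-valued function space L^p([0, 1]), p a positive integer. *)
Definition in_Lp (p : nat) m n (F : R -> 'M[C]_(m, n)) : Prop :=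
  forall i j,
    [/\ measurable_fun unit_itv (fun x => complex.Re (F x i j)),
        measurable_fun unit_itv (fun x => complex.Im (F x i j)) &
        mu.-integrable unit_itv
          (fun x => (complex.Re `|F x i j| ^+ p)%:E)].

Definition cintegral (D : set R) (f : R -> C) : C :=
  Complex (\int[mu]_(x in D) complex.Re (f x))
          (\int[mu]_(x in D) complex.Im (f x)).

Definition mxintegral (D : set R) m n (F : R -> 'M[C]_(m, n)) : 'M[C]_(m, n) :=
  \matrix_(i, j) cintegral D (fun x => F x i j).

Definition aeq m n (F G : R -> 'M[C]_(m, n)) : Prop := ae_eq mu unit_itv F G.

(* [W11 y dy]: y is the absolutely continuous representative of an element of
   W^{1,1}([0, 1]; C^n), and dy in L^1 is its derivative. *)
Definition W11 n (y dy : R -> 'cV[C]_n) : Prop :=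
  in_Lp 1 dy /\ forall x, unit_itv x -> y x = y 0 + mxintegral `[0, x] dy.

Definition inner n (f g : R -> 'cV[C]_n) : C :=
  cintegral unit_itv (fun x => \sum_(k < n) f x k 0 * (g x k 0)^*).

(* Linear algebra in L^2([0, 1]; C^n), all equalities being a.e. *)

Definition lin_indep n k (e : 'I_k -> R -> 'cV[C]_n) : Prop :=
  forall c : 'I_k -> C,
    aeq (fun x => \sum_(i < k) c i *: e i x) (fun=> 0) -> forall i, c i = 0.

Definition lin_span n (S : set (R -> 'cV[C]_n)) : set (R -> 'cV[C]_n) :=
  [set f | in_Lp 2 f /\
     exists k (s : 'I_k -> R -> 'cV[C]_n) (c : 'I_k -> C),
       (forall i, S (s i)) /\ aeq f (fun x => \sum_(i < k) c i *: s i x)].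

(* S is an algebraic basis of V; injectivity of e refers to equality of
   functions, so S contains at most one representative of each class. *)
Definition is_basis n (V S : set (R -> 'cV[C]_n)) : Prop :=
  [/\ S `<=` V,
      (forall k (e : 'I_k -> R -> 'cV[C]_n),
         injective e -> (forall i, S (e i)) -> lin_indep e) &
      V `<=` lin_span S].

Definition orthogonal_complement n (S : set (R -> 'cV[C]_n)) :
    set (R -> 'cV[C]_n) :=
  [set f | in_Lp 2 f /\ forall g, S g -> inner f g = 0].

Definition dimension n (V : set (R -> 'cV[C]_n)) : \bar R :=
  ereal_sup [set k%:R%:E | k in [set k : nat |
    exists e : 'I_k -> R -> 'cV[C]_n, (forall i, V (e i)) /\ lin_indep e]].

Definition defect n (S : set (R -> 'cV[C]_n)) : \bar R :=
  dimension (orthogonal_complement (lin_span S)).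

End FunctionSpaces.

Section Operator.
Context {R : realType} {n : nat}.
Local Notation C := R[i].

(* Unbounded operators in L^2([0, 1]; C^n) are given by their graphs, closed
   under a.e. equality. *)

(* Graph of L_{C,D}(Q), with Cm and Dm the boundary matrices C and D. *)
Definition L_op (B Cm Dm : 'M[C]_n) (Q : R -> 'M[C]_n)
    (y f : R -> 'cV[C]_n) : Prop :=
  [/\ in_Lp 2 y, in_Lp 2 f &
      exists z dz : R -> 'cV[C]_n,
        [/\ W11 z dz,
            aeq y z,
            aeq f (fun x => - ('i)%C *: (invmx B *m dz x) + Q x *m z x) &
            Cm *m z 0 + Dm *m z 1 = 0]].

Implicit Type T : (R -> 'cV[C]_n) -> (R -> 'cV[C]_n) -> Prop.

Definition eigenvalue_op T : set C :=
  [set lambda | exists y,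
     T y (fun x => lambda *: y x) /\ ~ aeq y (fun=> 0)].

(* ker (T - lambda)^m *)
Fixpoint ker_pow T (lambda : C) (m : nat) (y : R -> 'cV[C]_n) : Prop :=
  match m with
  | 0 => in_Lp 2 y /\ aeq y (fun=> 0)
  | m'.+1 => exists f, T y f /\
               ker_pow T lambda m' (fun x => f x - lambda *: y x)
  end.

Definition root_subspace T (lambda : C) : set (R -> 'cV[C]_n) :=
  [set y | exists m, ker_pow T lambda m y].

Definition is_root_system T (S : set (R -> 'cV[C]_n)) : Prop :=
  exists E : C -> set (R -> 'cV[C]_n),
    (forall lambda, eigenvalue_op T lambda ->
       is_basis (root_subspace T lambda) (E lambda)) /\
    S = \bigcup_(lambda in eigenvalue_op T) E lambda.

End Operator.

(* Main.v *)
Require Import Defs.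
From mathcomp Require Import all_boot all_order all_algebra.
From mathcomp Require Import all_classical all_reals all_analysis.
From mathcomp Require Import measurable_realfun complex ring lra.
Set Implicit Arguments.
Unset Strict Implicit.
Unset Printing Implicit Defensive.
Import Order.TTheory GRing.Theory Num.Theory.
Import numFieldNormedType.Exports.
Local Open Scope classical_set_scope.
Local Open Scope ring_scope.

(** The hypotheses make the boundary condition y(0) = A y(1) persist inside the
    interval.  If y solves -i B^-1 y' + Q y = lambda y, then so does
    w(x) = A y(1 - x) on [0, eps]: the reflection changes the sign of y', the
    relation A B = - B A restores it, and the assumption on Q near the endpoints
    turns A Q(1 - x) A^-1 into Q(x).  Moreover w(0) = A y(1) = y(0), so uniqueness
    for the Cauchy problem gives y(x) = A y(1 - x) on [0, eps].  The argument
    also works with a right-hand side having the same symmetry, so by induction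
    on m it covers all of ker (L - lambda)^m, and by linearity the span of any
    root system (lemmas [end_symmetric_resolvent], [root_end_symmetric],
    [end_symmetric_sum]).

    A symmetric g is orthogonal to every function equal to a constant vector v
    on a set I near 0, to - A^* v on the mirror image of I, and to 0 elsewhere:
    the two contributions to the inner product cancel under x |-> 1 - x
    ([antisymmetric_bump_orthogonal]).  Disjoint sets I give linearly independent
    functions ([antisymmetric_bump_lin_indep]), and there is room for any number
    of disjoint intervals in [0, eps], whence an infinite defect.

    Since Q is only integrable, uniqueness is proved for the integral equation
    u(x) = \int_0^x M u ([volterra_unique]): G(x) = \int_0^x |M u| is
    nondecreasing and G(y) - G(x) <= G(y) \int_x^y |M|, so G cannot leave 0 where
    the continuous function x |-> \int_0^x |M| varies by less than 1. *)

(** * Lebesgue measure and the reflection of the unit interval *)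

#[local] Instance lebesgue_ae_filter (R : realType) :
  Filter (nbhs (almost_everywhere (@lebesgue_measure R))) :=
  ae_filter_ringOfSetsType (@lebesgue_measure R).

Section Mirror.
Context {R : realType}.
Local Notation mu := (@lebesgue_measure R).
Local Notation Rm := (measurableTypeR R).

Definition mirror : Rm -> Rm := fun x : R => 1 - x.

Lemma mirrorK : involutive mirror.
Proof. by move=> x; rewrite /mirror; ring. Qed.

Lemma measurable_mirror : measurable_fun setT mirror.
Proof. by apply: measurable_funB. Qed.

Lemma measurable_preimage_mirror (D : set Rm) :
  measurable D -> measurable (mirror @^-1` D).
Proof.
by move=> mD; rewrite -[X in measurable X]setTI; exact: measurable_mirror.
Qed.

Lemma preimage_mirror_itv (a b : R) (s t : bool) :
  mirror @^-1` [set` Interval (BSide s a) (BSide t b)] =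
  [set` Interval (BSide (~~ t) (1 - b)) (BSide (~~ s) (1 - a))].
Proof.
by apply/seteqP; split=> x /=; rewrite /mirror !in_itv;
  case: s; case: t => /= /andP[? ?]; apply/andP; split; lra.
Qed.

(** A Borel measure is determined by its values on half-open intervals; the
    reflection exchanges their open and closed ends, and points are null. *)
Lemma pushforward_mirror (D : set Rm) : measurable D ->
  pushforward mu mirror D = mu D.
Proof.
move=> mD; apply/esym/lebesgue_measure_unique => //=.
  exact: measurable_mirror.
move=> mr _ [[a b]] _ <-.
rewrite /pushforward preimage_mirror_itv !lebesgue_measure_itv/= !lte_fin.
rewrite -!EFinB.
have -> : (1 - b < 1 - a) = (a < b) by apply/idP/idP; lra.
by case: ifP => // _; congr (_%:E); ring.
Qed.

Lemma ae_mirror (P : R -> Prop) :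
  {ae mu, forall x, P x} -> {ae mu, forall x, P (mirror x)}.
Proof.
move=> [N [mN N0 PN]]; exists (mirror @^-1` N); split.
- exact: measurable_preimage_mirror.
- by rewrite -N0 -[RHS]pushforward_mirror.
- by move=> x /= nP; exact: PN.
Qed.

Lemma ge0_integral_mirror (D : set Rm) (f : R -> \bar R) :
  measurable D -> measurable_fun D f -> (forall y, D y -> (0 <= f y)%E) ->
  (\int[mu]_(x in mirror @^-1` D) f (mirror x) = \int[mu]_(x in D) f x)%E.
Proof.
move=> mD mf f0; have := @ge0_integral_pushforward _ _ _ _ R _
  measurable_mirror mu D f mD mf.
move=> <-; last by move=> y /set_mem; exact: f0.
apply: eq_measure_integral => //=.
  exact: measurable_mirror.
by move=> mr A mA AD; exact: pushforward_mirror.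
Qed.

Lemma measurable_fun_mirror d (T : measurableType d) (D : set Rm) (f : R -> T) :
  measurable D -> measurable_fun D f ->
  measurable_fun (mirror @^-1` D) (f \o mirror).
Proof.
move=> mD mf; apply: (@measurable_comp _ _ _ _ _ _ D) => //.
  by move=> _ [x Dx <-].
by apply: measurable_funTS; exact: measurable_mirror.
Qed.

Lemma integrable_mirror (D : set Rm) (f : R -> \bar R) :
  measurable D -> mu.-integrable D f ->
  mu.-integrable (mirror @^-1` D) (f \o mirror).
Proof.
move=> mD /integrableP[mf foo]; apply/integrableP; split.
  exact: measurable_fun_mirror.
have := @ge0_integral_mirror D (fun x => `|f x|%E) mD.
by move=> -> //; apply: measurableT_comp.
Qed.

(** The positive and the negative part are transported separately, so the
    identity survives even when both have infinite integral. *)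
Lemma integral_mirror (D : set Rm) (f : R -> \bar R) :
  measurable D -> measurable_fun D f ->
  (\int[mu]_(x in mirror @^-1` D) f (mirror x) = \int[mu]_(x in D) f x)%E.
Proof.
move=> mD mf; rewrite integralE [RHS]integralE.
rewrite -(ge0_integral_mirror mD (measurable_funepos mf)); last by [].
rewrite -(ge0_integral_mirror mD (measurable_funeneg mf)); last by [].
by congr (_ - _)%E; apply: eq_integral => x _; rewrite unlock.
Qed.

End Mirror.

(** * Integrals of complex-valued functions *)

Section ComplexIntegral.
Context {R : realType}.
Local Notation C := R[i].
Local Notation mu := (@lebesgue_measure R).
Local Notation Rm := (measurableTypeR R).

Definition cintegrable (D : set Rm) (f : R -> C) : Prop :=
  mu.-integrable D (fun x => (complex.Re (f x))%:E) /\
  mu.-integrable D (fun x => (complex.Im (f x))%:E).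

Lemma Re_add (z w : C) : complex.Re (z + w) = complex.Re z + complex.Re w.
Proof. by case: z => ? ?; case: w. Qed.
Lemma Im_add (z w : C) : complex.Im (z + w) = complex.Im z + complex.Im w.
Proof. by case: z => ? ?; case: w. Qed.
Lemma Re_mul (z w : C) : complex.Re (z * w) =
  complex.Re z * complex.Re w - complex.Im z * complex.Im w.
Proof. by case: z => ? ?; case: w. Qed.
Lemma Im_mul (z w : C) : complex.Im (z * w) =
  complex.Re z * complex.Im w + complex.Im z * complex.Re w.
Proof. by case: z => ? ?; case: w. Qed.
Lemma Re_conjc (z : C) : complex.Re z^* = complex.Re z.
Proof. by case: z. Qed.
Lemma Im_conjc (z : C) : complex.Im z^* = - complex.Im z.
Proof. by case: z. Qed.

Lemma complex_ext (z w : C) : complex.Re z = complex.Re w ->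
  complex.Im z = complex.Im w -> z = w.
Proof. by case: z => ? ?; case: w => ? ? /= -> ->. Qed.

Lemma cintegrableS (D E : set Rm) f : measurable D -> measurable E ->
  E `<=` D -> cintegrable D f -> cintegrable E f.
Proof.
by move=> mD mE ED [fR fI]; split; exact: (integrableS mD mE ED).
Qed.

Lemma cintegrableD (D : set Rm) f g : measurable D ->
  cintegrable D f -> cintegrable D g -> cintegrable D (fun x => f x + g x).
Proof.
move=> mD [fR fI] [gR gI]; split.
  under eq_fun do rewrite Re_add EFinD.
  exact: integrableD.
under eq_fun do rewrite Im_add EFinD.
exact: integrableD.
Qed.

Lemma cintegrableZ (D : set Rm) c f : measurable D ->
  cintegrable D f -> cintegrable D (fun x => c * f x).
Proof.
move=> mD [fR fI]; split.
  under eq_fun do rewrite Re_mul EFinB !EFinM.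
  by apply: integrableB => //; exact: integrableZl.
under eq_fun do rewrite Im_mul EFinD !EFinM.
by apply: integrableD => //; exact: integrableZl.
Qed.

Lemma cintegrable0 (D : set Rm) : cintegrable D (fun=> 0).
Proof. by split; exact: integrable0. Qed.

Lemma cintegrable_sum (D : set Rm) I (s : seq I) (f : I -> R -> C) :
  measurable D -> (forall i, cintegrable D (f i)) ->
  cintegrable D (fun x => \sum_(i <- s) f i x).
Proof.
move=> mD fD; elim: s => [|i s IH].
  under eq_fun do rewrite big_nil.
  exact: cintegrable0.
under eq_fun do rewrite big_cons.
exact: cintegrableD.
Qed.

Lemma cintegrable_mirror (D : set Rm) f : measurable D ->
  cintegrable D f -> cintegrable (mirror @^-1` D) (f \o mirror).
Proof.
by move=> mD [fR fI]; split;
  [apply: (integrable_mirror mD fR)|apply: (integrable_mirror mD fI)].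
Qed.

Lemma cintegralD (D : set Rm) f g : measurable D ->
  cintegrable D f -> cintegrable D g ->
  cintegral D (fun x => f x + g x) = cintegral D f + cintegral D g.
Proof.
move=> mD [fR fI] [gR gI]; apply: complex_ext; rewrite /cintegral /=.
  by rewrite -RintegralD//; apply: eq_Rintegral => x _; rewrite Re_add.
by rewrite -RintegralD//; apply: eq_Rintegral => x _; rewrite Im_add.
Qed.

Lemma cintegralZ (D : set Rm) c f : measurable D ->
  cintegrable D f -> cintegral D (fun x => c * f x) = c * cintegral D f.
Proof.
move=> mD [fR fI].
have iZ k (h : R -> R) : mu.-integrable D (EFin \o h) ->
  mu.-integrable D (EFin \o (fun x => k * h x)).
  move=> ih; have -> : EFin \o (fun x => k * h x) =
    (fun x => k%:E * (EFin \o h) x)%E by apply/funext => x /=; rewrite EFinM.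
  exact: integrableZl.
apply: complex_ext; rewrite /cintegral /= ?Re_mul ?Im_mul /=.
  rewrite -!RintegralZl// -RintegralB//; try exact: iZ.
  by apply: eq_Rintegral => x _; rewrite Re_mul.
rewrite -!RintegralZl// -RintegralD//; try exact: iZ.
by apply: eq_Rintegral => x _; rewrite Im_mul.
Qed.

Lemma cintegral0 (D : set Rm) : cintegral D (fun=> 0) = 0.
Proof.
by apply: complex_ext; rewrite /cintegral /= /Rintegral integral0.
Qed.

Lemma cintegral_sum (D : set Rm) I (s : seq I) (f : I -> R -> C) :
  measurable D -> (forall i, cintegrable D (f i)) ->
  cintegral D (fun x => \sum_(i <- s) f i x) = \sum_(i <- s) cintegral D (f i).
Proof.
move=> mD fD; elim: s => [|i s IH].
  rewrite big_nil -[RHS](cintegral0 D).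
  by congr cintegral; apply/funext => x; rewrite big_nil.
rewrite big_cons -IH -cintegralD//; last exact: cintegrable_sum.
by congr cintegral; apply/funext => x; rewrite big_cons.
Qed.

Lemma cintegral_mirror (D : set Rm) f : measurable D -> cintegrable D f ->
  cintegral (mirror @^-1` D) (f \o mirror) = cintegral D f.
Proof.
move=> mD [fR fI]; rewrite /cintegral /Rintegral.
have := integral_mirror mD (measurable_int _ fR) => /= ->.
by have := integral_mirror mD (measurable_int _ fI) => /= ->.
Qed.

Lemma cintegral_ae_eq (D : set Rm) f g : measurable D ->
  cintegrable D f -> cintegrable D g -> ae_eq mu D f g ->
  cintegral D f = cintegral D g.
Proof.
move=> mD [fR fI] [gR gI] fg; rewrite /cintegral /Rintegral.
congr Complex; congr fine; apply: ae_eq_integral => //;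
  try exact: (measurable_int mu);
  by apply: filterS fg => x h Dx; rewrite h.
Qed.

Lemma cintegral_itv_split (a b c : R) f : a <= b -> b <= c ->
  cintegrable `[a, c] f ->
  cintegral `[a, c] f = cintegral `[a, b] f + cintegral `[b, c] f.
Proof.
move=> ab bc [fR fI].
have key (h : R -> R) : mu.-integrable `[a, c] (fun x => (h x)%:E) ->
  \int[mu]_(x in `[a, c]) h x =
  \int[mu]_(x in `[a, b]) h x + \int[mu]_(x in `[b, c]) h x.
  move=> ih; rewrite -[X in _ + X]Rintegral_itv_obnd_cbnd; last first.
    by apply: integrableS ih => //; apply: subset_itv; rewrite bnd_simp.
  by rewrite -(Rintegral_itvB (a := BLeft a) (b := BRight c) ih)
    ?bnd_simp// addrC subrK.
by apply: complex_ext; rewrite /cintegral /= key.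
Qed.

(** Equivalent to the modulus, but with it the estimate of an integral by the
    integral of the norm is just the real one for each of the two parts. *)
Definition l1norm (z : C) : R := `|complex.Re z| + `|complex.Im z|.

Lemma l1norm_ge0 z : 0 <= l1norm z.
Proof. by rewrite /l1norm addr_ge0. Qed.

Lemma l1norm_eq0 z : l1norm z = 0 -> z = 0.
Proof.
rewrite /l1norm => /eqP; rewrite paddr_eq0// !normr_eq0 => /andP[/eqP a /eqP b].
exact: complex_ext.
Qed.

Lemma l1normD z w : l1norm (z + w) <= l1norm z + l1norm w.
Proof.
rewrite /l1norm Re_add Im_add addrACA.
by apply: lerD; exact: ler_normD.
Qed.

Lemma l1normM z w : l1norm (z * w) <= l1norm z * l1norm w.
Proof.
rewrite /l1norm Re_mul Im_mul.
apply: (@le_trans _ _ ((`|complex.Re z * complex.Re w| +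
   `|complex.Im z * complex.Im w|) + (`|complex.Re z * complex.Im w| +
   `|complex.Im z * complex.Re w|))).
  by apply: lerD; [exact: ler_normB|exact: ler_normD].
rewrite !normrM; lra.
Qed.

Lemma l1norm_sum I (s : seq I) (f : I -> C) :
  l1norm (\sum_(i <- s) f i) <= \sum_(i <- s) l1norm (f i).
Proof.
elim: s => [|i s IH]; first by rewrite !big_nil /l1norm /= normr0 addr0.
rewrite !big_cons; apply: le_trans (l1normD _ _) _.
by rewrite lerD2l.
Qed.

Lemma integrable_l1norm (D : set Rm) f : measurable D -> cintegrable D f ->
  mu.-integrable D (fun x => (l1norm (f x))%:E).
Proof.
move=> mD [fR fI]; rewrite /l1norm; under eq_fun do rewrite EFinD.
apply: integrableD => //.
  exact: (integrable_norm fR).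
exact: (integrable_norm fI).
Qed.

Lemma l1norm_cintegral_le (D : set Rm) f : measurable D -> cintegrable D f ->
  l1norm (cintegral D f) <= \int[mu]_(x in D) l1norm (f x).
Proof.
move=> mD [fR fI]; rewrite /l1norm /cintegral /=.
rewrite RintegralD//; try exact: (integrable_norm fR);
  try exact: (integrable_norm fI).
by apply: lerD; exact: le_normr_Rintegral.
Qed.

Lemma Re_normc (z : C) :
  complex.Re `|z| = Num.sqrt (complex.Re z ^+ 2 + complex.Im z ^+ 2).
Proof. by rewrite normc_def. Qed.

Lemma sqr_Re_normc (z : C) :
  complex.Re `|z| ^+ 2 = complex.Re z ^+ 2 + complex.Im z ^+ 2.
Proof. by rewrite Re_normc sqr_sqrtr// addr_ge0// sqr_ge0. Qed.

Lemma ler_Re_normc (z : C) : `|complex.Re z| <= complex.Re `|z|.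
Proof. by rewrite Re_normc -sqrtr_sqr ler_wsqrtr// lerDl sqr_ge0. Qed.

Lemma ler_Im_normc (z : C) : `|complex.Im z| <= complex.Re `|z|.
Proof. by rewrite Re_normc -sqrtr_sqr ler_wsqrtr// lerDr sqr_ge0. Qed.

Lemma Re_normc_ge0 (z : C) : 0 <= complex.Re `|z|.
Proof. by rewrite Re_normc sqrtr_ge0. Qed.

Lemma cintegrable_le (D : set Rm) (f : R -> C) (g : R -> R) :
  measurable_fun D (fun x => complex.Re (f x)) ->
  measurable_fun D (fun x => complex.Im (f x)) -> measurable D ->
  (forall x, D x ->
     `|complex.Re (f x)| <= g x /\ `|complex.Im (f x)| <= g x) ->
  mu.-integrable D (fun x => (g x)%:E) -> cintegrable D f.
Proof.
move=> mR mI mD fg ig; split; apply: (le_integrable mD _ _ ig).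
- exact/measurable_EFinP.
- move=> x /fg[fRg _] /=.
  by rewrite lee_fin (le_trans fRg)// ler_norm.
- exact/measurable_EFinP.
- by move=> x /fg[_ fIg] /=; rewrite lee_fin (le_trans fIg)// ler_norm.
Qed.

Lemma measurable_unit_itv : measurable (unit_itv : set Rm).
Proof. exact: measurable_itv. Qed.

Lemma preimage_mirror_unit_itv : mirror @^-1` (unit_itv : set R) = unit_itv.
Proof. by rewrite preimage_mirror_itv /= subrr subr0. Qed.

Lemma integrable_cst_unit_itv (k : R) :
  mu.-integrable unit_itv (fun=> k%:E).
Proof.
apply: (@measurable_bounded_integrable _ _ R mu (cst k) unit_itv
  measurable_unit_itv).
- by rewrite /= lebesgue_measure_itv /= lte01 oppr0 adde0 ltry.
- exact: measurable_cst.
- by exists `|k|; split => // y ky x _; exact: ltW ky.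
Qed.

Lemma in_Lp1_cintegrable m n (F : R -> 'M[C]_(m, n)) i j : in_Lp 1 F ->
  cintegrable unit_itv (fun x => F x i j).
Proof.
move=> /(_ i j)[mR mI].
move/(cintegrable_le mR mI measurable_unit_itv); apply => x _.
by rewrite expr1 ler_Re_normc ler_Im_normc.
Qed.

Lemma in_Lp2_cintegrable m n (F : R -> 'M[C]_(m, n)) i j : in_Lp 2 F ->
  cintegrable unit_itv (fun x => F x i j).
Proof.
move=> /(_ i j)[mR mI iF].
(* L^2 is contained in L^1 on a finite measure space since |z| <= 1 + |z|^2. *)
have i1 : mu.-integrable unit_itv
    (fun x => (1 + complex.Re `|F x i j| ^+ 2)%:E).
  under eq_fun do rewrite EFinD.
  exact: (integrableD measurable_unit_itv (integrable_cst_unit_itv 1) iF).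
apply: (cintegrable_le mR mI measurable_unit_itv _ i1) => x _.
have := Re_normc_ge0 (F x i j); have := ler_Re_normc (F x i j).
by have := ler_Im_normc (F x i j); split; nra.
Qed.

End ComplexIntegral.

(** * Uniqueness for integral equations with integrable coefficients *)

Section Gronwall.
Context {R : realType}.
Local Notation C := R[i].
Local Notation mu := (@lebesgue_measure R).
Local Notation Rm := (measurableTypeR R).

(** Where H varies by less than 1, the inequality
    G y * (1 - (H y - H x)) <= G x carries the value 0 from x to y.  Applied just
    below the supremum s of the zeros of G it gives G s = 0, and applied just
    above s it contradicts s < e. *)
Lemma zero_propagation (e : R) (G H : R -> R) :
  {within `[0, e], continuous H} -> G 0 = 0 ->
  (forall x, 0 <= x <= e -> 0 <= G x) ->
  (forall x y, 0 <= x -> x <= y -> y <= e ->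
     0 <= G y - G x <= G y * (H y - H x)) ->
  forall x, 0 <= x <= e -> G x = 0.
Proof.
move=> Hcont G0 G_ge0 GH x /andP[x0 xe].
have e0 : 0 <= e by exact: le_trans xe.
pose Z := [set t : R | 0 <= t <= e /\ G t = 0].
have Z0 : Z 0 by split => //; rewrite lexx.
have supZ : has_sup Z.
  by split; [exists 0|exists e => t [/andP[]]].
set s := sup Z.
have s0 : 0 <= s by apply: ub_le_sup => //; case: supZ.
have se : s <= e by apply: ge_sup; [exists 0|move=> t [/andP[]]].
have [d d0 Hd] : exists2 d, 0 < d &
    forall t, 0 <= t <= e -> `|s - t| < d -> `|H s - H t| < 1.
  have sI : `[0, e]%classic s by rewrite /= in_itv /= s0 se.
  have /subspace_continuousP /(_ s sI) /cvgrPdist_lt /(_ 1 ltr01) := Hcont.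
  rewrite near_withinE => /nbhs_ballP[d /= d0 dH]; exists d => // t te st.
  by apply: dH => //=; rewrite in_itv.
have Gs : G s = 0.
  have [t Zt st] := sup_adherent d0 supZ; case: (Zt) => te Gt.
  have ts : t <= s by apply: ub_le_sup => //; case: supZ.
  case/andP: (te) => t0 _.
  have /andP[_] := GH t s t0 ts se; rewrite Gt subr0 => GsH.
  have Gs0 := G_ge0 s; rewrite s0 se in Gs0; move: (Gs0 isT) => {}Gs0.
  have : `|s - t| < d by rewrite ger0_norm ?subr_ge0//; rewrite -/s in st; lra.
  move=> /(Hd t te); rewrite ltr_norml => /andP[_ Hst].
  by apply/eqP; rewrite eq_le Gs0 andbT; nra.
have [es|se'] := eqVneq s e.
  have := GH x e x0 xe (lexx e); rewrite -es Gs mul0r sub0r => /andP[].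
  by rewrite oppr_ge0 => ? _; apply/eqP; rewrite eq_le G_ge0 ?x0 ?xe ?andbT.
have {se'} lt_se : s < e by rewrite lt_neqAle se' se.
exfalso; pose t := Num.min e (s + d / 2).
have st : s < t by rewrite lt_min lt_se /=; lra.
have tle : t <= e by rewrite ge_min lexx.
have td : t <= s + d / 2 by rewrite ge_min lexx orbT.
have t0 : 0 <= t by lra.
have := GH s t s0 (ltW st) tle; rewrite Gs subr0 => /andP[_ GtH].
have Gt0 : 0 <= G t by apply: G_ge0; rewrite t0 tle.
have : `|s - t| < d by rewrite ltr0_norm ?subr_lt0//; lra.
have te : 0 <= t <= e by rewrite t0 tle.
move=> /(Hd t te); rewrite ltr_norml => /andP[Hst _].
have Gt : G t = 0 by apply/eqP; rewrite eq_le Gt0 andbT; nra.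
have : t <= s by apply: ub_le_sup => //; case: supZ.
by rewrite leNgt st.
Qed.

(** As x |-> \int_0^x g is nondecreasing, the integral of g over an interval
    ]x, y] is at most \int_0^y g times the integral of m over it: this is the
    situation of [zero_propagation]. *)
Lemma integral_gronwall (e : R) (g m : R -> R) :
  0 <= e -> (forall x, 0 <= g x) -> (forall x, 0 <= m x) ->
  mu.-integrable `[0, e] (fun x => (g x)%:E) ->
  mu.-integrable `[0, e] (fun x => (m x)%:E) ->
  {ae mu, forall x, `[0, e]%classic x ->
     g x <= m x * \int[mu]_(t in `[0, x]) g t} ->
  forall x, 0 <= x <= e -> \int[mu]_(t in `[0, x]) g t = 0.
Proof.
move=> e0 g0 m0 ig im gm.
pose G x := \int[mu]_(t in `[0, x]) g t.
pose H x := \int[mu]_(t in `[0, x]) m t.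
have split_int (h : R -> R) x y : 0 <= x -> x <= y -> y <= e ->
    mu.-integrable `[0, e] (fun x => (h x)%:E) ->
    \int[mu]_(t in `[0, y]) h t - \int[mu]_(t in `[0, x]) h t =
    \int[mu]_(t in `]x, y]) h t.
  move=> x0 xy ye ih.
  rewrite (@Rintegral_itvB _ h (BLeft 0) (BRight y) x)// ?bnd_simp//.
  by apply: integrableS ih => //; apply: subset_itv; rewrite bnd_simp.
have Gmono x y : 0 <= x -> x <= y -> y <= e -> G x <= G y.
  move=> x0 xy ye; rewrite -subr_ge0 split_int//.
  by apply: Rintegral_ge0 => t _.
apply: (@zero_propagation e G H) => //.
- exact: parameterized_integral_continuous.
- by rewrite /G set_itv1 Rintegral_set1.
- by move=> x _; exact: Rintegral_ge0.
move=> x y x0 xy ye; rewrite subr_ge0 Gmono//=.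
rewrite /H !split_int//.
have sub : `]x, y] `<=` `[0, e] by apply: subset_itv; rewrite bnd_simp.
have igxy : mu.-integrable `]x, y] (fun x => (g x)%:E).
  exact: integrableS ig.
have imxy : mu.-integrable `]x, y] (fun x => (m x)%:E).
  exact: integrableS im.
rewrite mulrC -RintegralZr//.
have imG : mu.-integrable `]x, y] (fun t => (m t * G y)%:E).
  have -> : (fun t => (m t * G y)%:E) = (fun t => (G y)%:E * (m t)%:E)%E.
    by apply/funext => t; rewrite -EFinM mulrC.
  exact: integrableZl.
rewrite /Rintegral fine_le//; try exact: integrable_fin_num.
apply: ae_ge0_le_integral => //.
- by move=> t _; rewrite lee_fin.
- exact: (measurable_int mu).
- move=> t _; rewrite lee_fin mulr_ge0//.
  exact: Rintegral_ge0.
- exact: (measurable_int mu).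
apply: filterS gm => t gmt txy; have te := sub _ txy.
move: txy (te); rewrite /= !in_itv /= => /andP[xt ty] /andP[t0 _].
rewrite lee_fin (le_trans (gmt te))// ler_wpM2l// Gmono//.
Qed.

Lemma integrable_sumEFin (D : set Rm) I (s : seq I) (f : I -> R -> R) :
  measurable D -> (forall i, mu.-integrable D (fun x => (f i x)%:E)) ->
  mu.-integrable D (fun x => (\sum_(i <- s) f i x)%:E).
Proof.
move=> mD iF; under eq_fun do rewrite -sumEFin.
exact: integrable_sum.
Qed.

Lemma Rintegral_sum (D : set Rm) I (s : seq I) (f : I -> R -> R) :
  measurable D -> (forall i, mu.-integrable D (fun x => (f i x)%:E)) ->
  \int[mu]_(x in D) (\sum_(i <- s) f i x) =
  \sum_(i <- s) \int[mu]_(x in D) f i x.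
Proof.
move=> mD iF; elim: s => [|i s IH].
  rewrite big_nil -[RHS](mul0r (fine (mu D))) -Rintegral_cst//.
  by apply: eq_Rintegral => x _; rewrite big_nil.
rewrite big_cons -IH -RintegralD;
  [|exact: mD|exact: iF|exact: integrable_sumEFin].
by apply: eq_Rintegral => x _; rewrite big_cons.
Qed.

(** The values of u are bounded by the integral of g = |du|, so the equation
    du = M u becomes the scalar inequality g x <= |M x| * \int_0^x g. *)
Lemma volterra_unique n (e : R) (M : R -> 'M[C]_n) (u du : R -> 'cV[C]_n) :
  0 <= e ->
  (forall i j, cintegrable `[0, e] (fun x => M x i j)) ->
  (forall i, cintegrable `[0, e] (fun x => du x i 0)) ->
  (forall x, 0 <= x <= e -> u x = mxintegral `[0, x] du) ->
  {ae mu, forall x, `[0, e]%classic x -> du x = M x *m u x} ->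
  forall x, 0 <= x <= e -> u x = 0.
Proof.
move=> e0 iM idu udu duM.
pose N (v : 'cV[C]_n) := \sum_i l1norm (v i 0).
pose g x := N (du x).
pose m x := \sum_i \sum_j l1norm (M x i j).
have N_ge0 v : 0 <= N v by apply: sumr_ge0 => i _; exact: l1norm_ge0.
have m_ge0 x : 0 <= m x.
  by do 2 (apply: sumr_ge0 => ? _); exact: l1norm_ge0.
have Nu x : 0 <= x <= e -> N (u x) <= \int[mu]_(t in `[0, x]) g t.
  move=> x0e; rewrite udu//; case/andP: x0e => x0 xe.
  have idux i : cintegrable `[0, x] (fun x => du x i 0).
    by apply: cintegrableS (idu i) => //; apply: subset_itv; rewrite bnd_simp.
  rewrite Rintegral_sum//; last by move=> i; exact: integrable_l1norm.
  by apply: ler_sum => i _; rewrite mxE l1norm_cintegral_le.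
have g0 := @integral_gronwall e g m e0.
move=> x x0e; have : \int[mu]_(t in `[0, x]) g t = 0.
  apply: g0 x0e => //.
  - by move=> t; exact: N_ge0.
  - by apply: integrable_sumEFin => // i; exact: integrable_l1norm.
  - apply: integrable_sumEFin => // i; apply: integrable_sumEFin => // j.
    exact: integrable_l1norm.
  apply: filterS duM => t duMt te.
  have t0e : 0 <= t <= e by move: te; rewrite /= in_itv.
  apply: (@le_trans _ _ (m t * N (u t))); last first.
    by rewrite ler_wpM2l// Nu.
  rewrite /g /N duMt// mulr_suml; apply: ler_sum => i _.
  rewrite mxE; apply: le_trans (l1norm_sum _ _) _.
  rewrite mulr_suml; apply: ler_sum => j _.
  apply: le_trans (l1normM _ _) _; rewrite ler_wpM2l ?l1norm_ge0//.
  by rewrite (bigD1 j)//= lerDl sumr_ge0// => k _; exact: l1norm_ge0.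
move=> gx; have := Nu x x0e; rewrite gx => Nux.
have /eqP : N (u x) = 0 by apply/eqP; rewrite eq_le Nux N_ge0.
rewrite psumr_eq0; last by move=> i _; exact: l1norm_ge0.
move=> /allP ux; apply/matrixP => i j; rewrite ord1 mxE.
by apply: l1norm_eq0; apply/eqP/ux; rewrite mem_index_enum.
Qed.

End Gronwall.

(** * Integrals of matrix-valued functions *)

Section MatrixIntegral.
Context {R : realType}.
Local Notation C := R[i].
Local Notation mu := (@lebesgue_measure R).
Local Notation Rm := (measurableTypeR R).

Definition mxintegrable (D : set Rm) m n (F : R -> 'M[C]_(m, n)) : Prop :=
  forall i j, cintegrable D (fun x => F x i j).

Lemma mxintegrableS (D E : set Rm) m n (F : R -> 'M[C]_(m, n)) :
  measurable D -> measurable E -> E `<=` D ->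
  mxintegrable D F -> mxintegrable E F.
Proof. by move=> mD mE ED iF i j; exact: (cintegrableS mD mE ED (iF i j)). Qed.

Lemma mxintegrableD (D : set Rm) m n (F G : R -> 'M[C]_(m, n)) :
  measurable D -> mxintegrable D F -> mxintegrable D G ->
  mxintegrable D (fun x => F x + G x).
Proof.
move=> mD iF iG i j; under eq_fun do rewrite mxE.
exact: cintegrableD.
Qed.

Lemma mxintegrable_mulmx (D : set Rm) m n p (A : 'M[C]_(m, n))
    (F : R -> 'M[C]_(n, p)) :
  measurable D -> mxintegrable D F -> mxintegrable D (fun x => A *m F x).
Proof.
move=> mD iF i j; under eq_fun do rewrite mxE.
by apply: cintegrable_sum => // k; exact: cintegrableZ.
Qed.

Lemma mxintegrable_cst m n (A : 'M[C]_(m, n)) :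
  mxintegrable unit_itv (fun=> A).
Proof. by move=> i j; split; exact: integrable_cst_unit_itv. Qed.

Lemma mxintegrable_mirror (D : set Rm) m n (F : R -> 'M[C]_(m, n)) :
  measurable D -> mxintegrable D F ->
  mxintegrable (mirror @^-1` D) (fun x => F (mirror x)).
Proof. by move=> mD iF i j; exact: (cintegrable_mirror mD (iF i j)). Qed.

Lemma mxintegralD (D : set Rm) m n (F G : R -> 'M[C]_(m, n)) :
  measurable D -> mxintegrable D F -> mxintegrable D G ->
  mxintegral D (fun x => F x + G x) = mxintegral D F + mxintegral D G.
Proof.
move=> mD iF iG; apply/matrixP => i j; rewrite !mxE -cintegralD//.
by congr cintegral; apply/funext => x; rewrite mxE.
Qed.

Lemma mxintegral_mulmx (D : set Rm) m n p (A : 'M[C]_(m, n))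
    (F : R -> 'M[C]_(n, p)) :
  measurable D -> mxintegrable D F ->
  mxintegral D (fun x => A *m F x) = A *m mxintegral D F.
Proof.
move=> mD iF; apply/matrixP => i j; rewrite !mxE.
under eq_bigr do rewrite mxE -cintegralZ//.
rewrite -cintegral_sum//; last by move=> k; exact: cintegrableZ.
by congr cintegral; apply/funext => x; rewrite mxE.
Qed.

Lemma mxintegral_mirror (D : set Rm) m n (F : R -> 'M[C]_(m, n)) :
  measurable D -> mxintegrable D F ->
  mxintegral (mirror @^-1` D) (fun x => F (mirror x)) = mxintegral D F.
Proof.
move=> mD iF; apply/matrixP => i j; rewrite !mxE.
exact: (cintegral_mirror mD (iF i j)).
Qed.

Lemma mxintegral_itv_split (a b c : R) m n (F : R -> 'M[C]_(m, n)) :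
  a <= b -> b <= c -> mxintegrable `[a, c] F ->
  mxintegral `[a, c] F = mxintegral `[a, b] F + mxintegral `[b, c] F.
Proof.
move=> ab bc iF; apply/matrixP => i j; rewrite !mxE.
exact: cintegral_itv_split.
Qed.

End MatrixIntegral.

(** * The symmetry of root functions *)

Section RootFunctions.
Context {R : realType} {n : nat}.
Local Notation C := R[i].
Local Notation mu := (@lebesgue_measure R).
Variables (B A : 'M[C]_n) (Q : R -> 'M[C]_n) (eps : R).
Hypotheses (B_unit : B \in unitmx) (A_unit : A \in unitmx).
Hypothesis AB : A *m B = - (B *m A).
Hypothesis Q_L1 : in_Lp 1 Q.
Hypotheses (eps_ge0 : 0 <= eps) (eps_le1 : eps <= 1).
Hypothesis Q_sym : ae_eq mu `[0, eps]%classic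
  (fun x => Q (1 - x)) (fun x => invmx A *m Q x *m A).

Definition end_symmetric (y : R -> 'cV[C]_n) : Prop :=
  {ae mu, forall x, `[0, eps]%classic x -> y x = A *m y (1 - x)}.

Lemma sub_unit_itv : `[0, eps] `<=` (unit_itv : set R).
Proof. by apply: subset_itv; rewrite bnd_simp. Qed.

Lemma mirror_unit_itv (x : R) : unit_itv x -> unit_itv (mirror x).
Proof.
rewrite /unit_itv /= /mirror !in_itv /= => /andP[? ?].
by apply/andP; split; lra.
Qed.

Lemma end_symmetric_aeq (f g : R -> 'cV[C]_n) :
  aeq f g -> end_symmetric g -> end_symmetric f.
Proof.
move=> fg sg; apply: (filterS3 _ _ fg (ae_mirror fg) sg) => x fgx fgrx gx xe.
have x_unit := sub_unit_itv xe.
by rewrite fgx// fgrx ?gx//; exact: mirror_unit_itv.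
Qed.

Lemma end_symmetric_sum I (s : seq I) (c : I -> C) (f : I -> R -> 'cV[C]_n) :
  (forall i, end_symmetric (f i)) ->
  end_symmetric (fun x => \sum_(i <- s) c i *: f i x).
Proof.
move=> sf; elim: s => [|i s IH].
  by apply: aeW => x _; rewrite !big_nil mulmx0.
apply: (filterS2 _ _ (sf i) IH) => x fx sx xe.
by rewrite !big_cons fx// sx// mulmxDr scalemxAr.
Qed.

Lemma derivative_of_system (f z dz : 'cV[C]_n) (q : 'M[C]_n) :
  f = - ('i)%C *: (invmx B *m dz) + q *m z ->
  dz = ('i)%C *: (B *m (f - q *m z)).
Proof.
move=> ->; rewrite addrK -scalemxAr mulKVmx// scalerA mulrN.
by rewrite -expr2 sqr_i opprK scale1r.
Qed.

(** The differential expressions at x (unprimed) and at 1 - x (primed) combine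
    into the homogeneous system for the difference z(x) - A z(1 - x), because the
    derivative of A z(1 - x) is - A z'(1 - x) and A B = - B A. *)
Lemma difference_system (lambda : C) (f f' z z' dz dz' : 'cV[C]_n)
    (q q' : 'M[C]_n) :
  f = - ('i)%C *: (invmx B *m dz) + q *m z ->
  f' = - ('i)%C *: (invmx B *m dz') + q' *m z' ->
  q' = invmx A *m q *m A ->
  f - lambda *: z = A *m (f' - lambda *: z') ->
  dz + A *m dz' =
  (('i)%C *: (B *m (lambda%:M - q))) *m (z - A *m z').
Proof.
move=> /derivative_of_system -> /derivative_of_system -> -> flam.
rewrite -scalemxAr mulmxA AB mulNmx -scalerDr -scalemxAl.
rewrite -!(mulmxA B) -mulmxBr; congr (_ *: (_ *m _)).
rewrite !mulmxBl mul_scalar_mx.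
rewrite mulmxBr !mulmxA mulmxV// mul1mx.
move: flam; rewrite mulmxBr -scalemxAr => /eqP; rewrite subr_eq => /eqP ->.
rewrite mulmxBr scalerBr mulmxA.
move: (A *m f') (A *m z') (q *m z) (q *m A *m z') => a a' c c'.
by apply/matrixP => i j; rewrite !mxE; ring.
Qed.

(** The function u(x) = z(x) - A z(1 - x), where z is the continuous
    representative of y, vanishes at 0 by the boundary condition and solves
    u' = i B (lambda - Q) u on [0, eps] because the symmetric part of the
    right-hand side cancels; hence u = 0 there. *)
Lemma end_symmetric_resolvent (lambda : C) (y f : R -> 'cV[C]_n) :
  L_op B 1%:M (- A) Q y f -> end_symmetric (fun x => f x - lambda *: y x) ->
  end_symmetric y.
Proof.
move=> [_ _ [z [dz [[dzL1 zdz] yz fz bc]]]] fsym.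
pose u x := z x - A *m z (1 - x).
pose du x := dz x + A *m dz (mirror x).
pose M x := (('i)%C *: (B *m (lambda%:M - Q x))).
have idz : mxintegrable unit_itv dz by move=> i j; exact: in_Lp1_cintegrable.
have idzr : mxintegrable unit_itv (fun x => dz (mirror x)).
  rewrite -preimage_mirror_unit_itv.
  exact: (mxintegrable_mirror measurable_unit_itv).
have iAdzr := mxintegrable_mulmx A measurable_unit_itv idzr.
have idu := mxintegrableD measurable_unit_itv idz iAdzr.
have mI (a b : R) : measurable (`[a, b]%classic : set (measurableTypeR R)).
  exact: measurable_itv.
have sub (a b : R) : 0 <= a -> b <= 1 -> `[a, b] `<=` (unit_itv : set R).
  by move=> ? ?; apply: subset_itv; rewrite bnd_simp.
have z0 : z 0 = A *m z 1.
  by move/eqP: bc; rewrite mul1mx mulNmx subr_eq0 => /eqP.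
have u_int x : 0 <= x <= eps -> u x = mxintegral `[0, x] du.
  move=> /andP[x0 xe]; have x1 : x <= 1 := le_trans xe eps_le1.
  have xs : `[0, x] `<=` (unit_itv : set R) by exact: sub.
  rewrite mxintegralD//; try exact: (mxintegrableS measurable_unit_itv).
  rewrite mxintegral_mulmx//; try exact: (mxintegrableS measurable_unit_itv).
  have -> : `[0, x]%classic = mirror @^-1` `[1 - x, 1].
    by rewrite preimage_mirror_itv /= subrr subKr.
  rewrite mxintegral_mirror//; last first.
    apply: mxintegrableS idz => //; first exact: measurable_unit_itv.
    by apply: sub; lra.
  rewrite preimage_mirror_itv /= subrr subKr.
  have x_unit : unit_itv x by rewrite /unit_itv /= in_itv /= x0 x1.
  have rx_unit : unit_itv (1 - x).
    by rewrite /unit_itv /= in_itv /=; apply/andP; split; lra.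
  have one_unit : unit_itv (1 : R) by rewrite /unit_itv /= in_itv /= ler01 lexx.
  have z1 : z 1 = z (1 - x) + mxintegral `[1 - x, 1] dz.
    have x01 : 0 <= 1 - x by lra.
    have x11 : 1 - x <= 1 by lra.
    rewrite (zdz 1 one_unit) (mxintegral_itv_split x01 x11 idz) addrA.
    by rewrite -(zdz _ rx_unit).
  (* As z 0 = A z 1, the two terms A z(1 - x) cancel and leave the integral of
     A dz over [1 - x, 1], the mirror image of [0, x]. *)
  rewrite /u zdz// {1}z0 z1 mulmxDr.
  by rewrite addrAC [A *m z (1 - x) + _]addrC addrK addrC.
have iM : mxintegrable `[0, eps] M.
  have -> : M = (fun x =>
      (('i)%C *: (B *m lambda%:M)) + (- (('i)%C *: B)) *m Q x).
    by apply/funext => x; rewrite /M mulmxBr scalerBr mulNmx -scalemxAl.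
  apply: (mxintegrableS measurable_unit_itv) sub_unit_itv _; first exact: mI.
  apply: (mxintegrableD measurable_unit_itv); first exact: mxintegrable_cst.
  apply: (mxintegrable_mulmx _ measurable_unit_itv) => i j.
  exact: in_Lp1_cintegrable.
have duM : {ae mu, forall x, `[0, eps]%classic x -> du x = M x *m u x}.
  have yzr := ae_mirror yz.
  have fzr := ae_mirror fz.
  apply: (filterS3 _ _ (filterI yz yzr) (filterI fz fzr) (filterI fsym Q_sym)).
  move=> x [yx yrx] [fx frx] [sx Qx] xe.
  have x_unit := sub_unit_itv xe.
  have rx_unit := mirror_unit_itv x_unit.
  apply: difference_system (fx x_unit) (frx rx_unit) (Qx xe) _.
  by rewrite -yx// -yrx//; exact: sx.
have idu0 i : cintegrable `[0, eps] (fun x => du x i 0).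
  exact: (cintegrableS measurable_unit_itv (mI _ _) sub_unit_itv (idu i 0)).
have u0 := volterra_unique eps_ge0 iM idu0 u_int duM.
apply: (filterS2 _ _ yz (ae_mirror yz)) => x yx yrx xe.
have x_unit := sub_unit_itv xe.
have rx_unit := mirror_unit_itv x_unit.
rewrite yx// yrx//; apply/eqP; rewrite -subr_eq0; apply/eqP/u0.
by move: xe; rewrite /= in_itv.
Qed.

Lemma root_end_symmetric (lambda : C) (y : R -> 'cV[C]_n) :
  root_subspace (L_op B 1%:M (- A) Q) lambda y -> end_symmetric y.
Proof.
case=> m; elim: m y => [|m IH] y /=.
  case=> _ y0; apply: (end_symmetric_aeq y0).
  by apply: aeW => x _; rewrite mulmx0.
by case=> f [yf /IH]; exact: end_symmetric_resolvent.
Qed.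

End RootFunctions.

(** * Functions orthogonal to the symmetric ones *)

Section OrthogonalFunctions.
Context {R : realType} {n : nat}.
Local Notation C := R[i].
Local Notation mu := (@lebesgue_measure R).
Local Notation Rm := (measurableTypeR R).

Lemma cintegrable_conj (D : set Rm) (f : R -> C) :
  cintegrable D f -> cintegrable D (fun x => (f x)^*).
Proof.
move=> [fR fI]; split.
  by under eq_fun do rewrite Re_conjc.
under eq_fun do rewrite Im_conjc EFinN.
exact: integrableN.
Qed.

Lemma Re_real_mul (r : R) (z : C) : complex.Re (r%:C%C * z) = r * complex.Re z.
Proof. by rewrite Re_mul /= mul0r subr0. Qed.

Lemma Im_real_mul (r : R) (z : C) : complex.Im (r%:C%C * z) = r * complex.Im z.
Proof. by rewrite Im_mul /= mul0r addr0. Qed.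

Lemma indic_bounds (I : set Rm) x : 0 <= (\1_I x : R) <= 1.
Proof. by rewrite indicE; case: (_ \in _); rewrite ?lexx ler01. Qed.

Lemma indic_mirror (I : set Rm) (x : R) :
  \1_(mirror @^-1` I) x = \1_I (mirror x) :> R.
Proof. by rewrite !indicE. Qed.

Lemma cintegrable_indic (D I : set Rm) (f : R -> C) :
  measurable D -> measurable I -> cintegrable D f ->
  cintegrable D (fun x => (\1_I x)%:C%C * f x).
Proof.
move=> mD mI.
have key (h : R -> R) : mu.-integrable D (fun x => (h x)%:E) ->
    mu.-integrable D (fun x => (\1_I x * h x)%:E).
  move=> ih; apply: (le_integrable mD _ _ ih).
    apply/measurable_EFinP; apply: measurable_funM.
      exact: measurable_indic.
    by have /measurable_EFinP := measurable_int mu ih.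
  move=> x _ /=; rewrite lee_fin normrM.
  have /andP[i0 i1] := indic_bounds I x.
  by rewrite (ger0_norm i0) ler_piMl.
move=> [fR fI]; split.
  by under eq_fun do rewrite Re_real_mul; exact: key.
by under eq_fun do rewrite Im_real_mul; exact: key.
Qed.

Lemma bounded_in_Lp2 m p (F : R -> 'M[C]_(m, p)) (M : 'I_m -> 'I_p -> R) :
  (forall i j, measurable_fun setT (fun x => complex.Re (F x i j))) ->
  (forall i j, measurable_fun setT (fun x => complex.Im (F x i j))) ->
  (forall x i j, l1norm (F x i j) <= M i j) -> in_Lp 2 F.
Proof.
move=> mR mI FM i j.
have mRu := measurable_funTS (mR i j) : measurable_fun unit_itv _.
have mIu := measurable_funTS (mI i j) : measurable_fun unit_itv _.
split => //.
apply: (le_integrable measurable_unit_itv _ _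
  (integrable_cst_unit_itv (M i j ^+ 2))).
  apply/measurable_EFinP; apply: (eq_measurable_fun
    (fun x => complex.Re (F x i j) ^+ 2 + complex.Im (F x i j) ^+ 2)).
    by move=> x _; exact/esym/sqr_Re_normc.
  by apply: measurable_funD; apply: measurable_funX.
move=> x _ /=; rewrite lee_fin.
have -> : complex.Re `|F x i j| ^+ 2 =
    complex.Re (F x i j) ^+ 2 + complex.Im (F x i j) ^+ 2.
  exact: sqr_Re_normc.
rewrite !ger0_norm ?addr_ge0 ?sqr_ge0//.
have := FM x i j; rewrite /l1norm.
rewrite -(real_normK (num_real (complex.Re _))).
rewrite -(real_normK (num_real (complex.Im _))).
have := normr_ge0 (complex.Re (F x i j)).
have := normr_ge0 (complex.Im (F x i j)).
by nra.
Qed.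

Definition adjointmx (A : 'M[C]_n) : 'M[C]_n := (map_mx Num.conj A)^T.

Definition dot (v w : 'cV[C]_n) : C := \sum_k v k 0 * (w k 0)^*.

Lemma dot_adjointmx (A : 'M[C]_n) v w :
  dot (adjointmx A *m v) w = dot v (A *m w).
Proof.
rewrite /dot.
under eq_bigr do rewrite mxE mulr_suml.
under [RHS]eq_bigr do rewrite mxE rmorph_sum mulr_sumr.
rewrite exchange_big; apply: eq_bigr => i _; apply: eq_bigr => j _ /=.
by rewrite !mxE rmorphM /=; ring.
Qed.

Definition antisymmetric_bump (A : 'M[C]_n) (I : set Rm) (v : 'cV[C]_n)
    (x : R) : 'cV[C]_n :=
  (\1_I x)%:C%C *: v - (\1_I (mirror x))%:C%C *: (adjointmx A *m v).

Lemma antisymmetric_bump_in_L2 (A : 'M[C]_n) (I : set Rm) v :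
  measurable I -> in_Lp 2 (antisymmetric_bump A I v).
Proof.
move=> mI; pose w := adjointmx A *m v.
have mJ : measurable (mirror @^-1` I) by exact: measurable_preimage_mirror.
have m1 : measurable_fun setT (fun x : Rm => \1_I x : R).
  exact: measurable_indic.
have m2 : measurable_fun setT (fun x : Rm => \1_I (mirror x) : R).
  by have := @measurable_indic _ Rm R setT (mirror @^-1` I) mJ.
pose M i (j : 'I_1) := l1norm (v i j) + l1norm (w i j).
apply: (@bounded_in_Lp2 _ _ _ M) => [i j|i j|x i j].
- have -> : (fun x => complex.Re (antisymmetric_bump A I v x i j)) =
     (fun x => \1_I x * complex.Re (v i j) -
               \1_I (mirror x) * complex.Re (w i j)).
    apply/funext => x; rewrite 4!mxE Re_add -Re_real_mul.
    by rewrite -mulNr -Re_real_mul rmorphN mulNr.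
  by apply: measurable_funB; apply: measurable_funM.
- have -> : (fun x => complex.Im (antisymmetric_bump A I v x i j)) =
     (fun x => \1_I x * complex.Im (v i j) -
               \1_I (mirror x) * complex.Im (w i j)).
    apply/funext => x; rewrite 4!mxE Im_add -Im_real_mul.
    by rewrite -mulNr -Im_real_mul rmorphN mulNr.
  by apply: measurable_funB; apply: measurable_funM.
have l1Z (r : R) z : 0 <= r <= 1 -> l1norm (r%:C%C * z) <= l1norm z.
  move=> /andP[r0 r1]; rewrite /l1norm Re_real_mul Im_real_mul !normrM.
  by rewrite (ger0_norm r0) -mulrDr ler_piMl// addr_ge0.
rewrite 4!mxE; apply: le_trans (l1normD _ _) _; apply: lerD.
  by rewrite l1Z// indic_bounds.
have -> z : l1norm (- z) = l1norm z.
  by case: z => ? ?; rewrite /l1norm /= !normrN.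
by rewrite l1Z// indic_bounds.
Qed.

(** The integrand is K(x) - K(1 - x) almost everywhere, where
    K(x) = 1_I(x) <v, g(x)>: on the mirror image of I the symmetry of g gives
    <A^* v, g(x)> = <v, A g(x)> = <v, g(1 - x)>. *)
Lemma antisymmetric_bump_orthogonal (A : 'M[C]_n) (eps : R) (I : set Rm) v g :
  measurable I -> I `<=` `[0, eps] -> in_Lp 2 g -> end_symmetric A eps g ->
  inner (antisymmetric_bump A I v) g = 0.
Proof.
move=> mI I_eps gL2 gsym.
pose K (J : set Rm) w (x : R) := (\1_J x)%:C%C * dot w (g x).
have mU := @measurable_unit_itv R.
have iK J w : measurable J -> cintegrable unit_itv (K J w).
  move=> mJ; apply: cintegrable_indic => //; apply: cintegrable_sum => // k.
  apply: cintegrableZ => //; apply: cintegrable_conj.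
  exact: in_Lp2_cintegrable.
have mJ : measurable (mirror @^-1` I) by exact: measurable_preimage_mirror.
have innerE : inner (antisymmetric_bump A I v) g = cintegral unit_itv
   (fun x => K I v x + (-1) * K (mirror @^-1` I) (adjointmx A *m v) x).
  congr cintegral; apply/funext => x.
  rewrite /K /dot !mulr_sumr -big_split /=; apply: eq_bigr => k _.
  rewrite /antisymmetric_bump 4!mxE.
  rewrite indic_mirror.
  ring.
rewrite innerE cintegralD//; [|exact: iK|apply: cintegrableZ => //; exact: iK].
rewrite cintegralZ//; last exact: iK.
have -> : cintegral unit_itv (K (mirror @^-1` I) (adjointmx A *m v)) =
    cintegral unit_itv (K I v).
  rewrite -(cintegral_mirror mU (iK I v mI)).
  rewrite preimage_mirror_unit_itv; apply: cintegral_ae_eq => //.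
    exact: iK.
    have := cintegrable_mirror mU (iK I v mI).
    by rewrite preimage_mirror_unit_itv.
  have := ae_mirror gsym.
  apply: filterS => x gx _.
  rewrite /K /= dot_adjointmx.
  rewrite indic_mirror.
  have [xI|xI] := pselect (I (mirror x)).
    by rewrite (gx (I_eps _ xI)) -[1 - _]/(mirror (mirror x)) mirrorK.
  by rewrite indicE memNset// !mul0r.
by rewrite mulN1r subrr.
Qed.

Lemma ae_exists (D : set Rm) (P : R -> Prop) : measurable D ->
  (0 < mu D)%E -> {ae mu, forall x, P x} -> exists2 x, D x & P x.
Proof.
move=> mD D0 [N [mN N0 PN]]; apply: contrapT => nP.
have DN : D `<=` N.
  by move=> x Dx; apply: PN => Px; apply: nP; exists x.
have : (mu D <= mu N)%E by apply: le_measure; rewrite ?inE.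
by rewrite N0 leNgt D0.
Qed.

(** On I j only the j-th function is nonzero, and it is constantly v there: the
    other sets are disjoint from I j, and the mirror images all lie beyond 1/2. *)
Lemma antisymmetric_bump_lin_indep (A : 'M[C]_n) (k : nat)
    (I : 'I_k -> set Rm) v :
  v != 0 -> (forall i, measurable (I i)) -> (forall i, (0 < mu (I i))%E) ->
  (forall i, I i `<=` `[0, 2^-1[) -> trivIset setT I ->
  lin_indep (fun i => antisymmetric_bump A (I i) v).
Proof.
move=> v0 mI I0 I_half I_triv c csum j.
have [x Ijx cx] := ae_exists (mI j) (I0 j) csum.
have := I_half _ _ Ijx; rewrite /= in_itv /= => /andP[x0 xh].
have x_unit : unit_itv x.
  by rewrite /unit_itv /= in_itv /=; apply/andP; split; lra.
move/(_ x_unit): cx; rewrite (bigD1 j)//= big1 => [|i ij]; last first.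
  rewrite /antisymmetric_bump [\1_(I i) x]indicE memNset; last first.
    move=> Iix; move/eqP: ij; apply; apply: I_triv => //.
    by exists x.
  rewrite indicE memNset ?scale0r ?subrr ?scaler0//.
  move=> /I_half; rewrite /= in_itv /= /mirror => /andP[_]; lra.
rewrite /antisymmetric_bump indicE mem_set// indicE memNset; last first.
  by move=> /I_half; rewrite /= in_itv /= /mirror => /andP[_]; lra.
rewrite scale0r subr0 scale1r addr0 => /eqP.
by rewrite scaler_eq0 (negbTE v0) orbF => /eqP.
Qed.

End OrthogonalFunctions.

Theorem proposition4p13 (R : realType) (n : nat) (n_gt0 : (0 < n)%N)
    (b : 'rV[R[i]]_n) (B_unit : diag_mx b \in unitmx)
    (Q : R -> 'M[R[i]]_n) (Q_L1 : in_Lp 1 Q)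
    (A : 'M[R[i]]_n) (detA_neq0 : \det A != 0)
    (AB_anticomm : A *m diag_mx b + diag_mx b *m A = 0)
    (eps : R) (eps_gt0 : 0 < eps) (eps_le1 : eps <= 1)
    (Q_sym : ae_eq (@lebesgue_measure R) `[0, eps]%classic
               (fun x => Q (1 - x)) (fun x => invmx A *m Q x *m A))
    (S : set (R -> 'cV[R[i]]_n))
    (S_root : is_root_system (L_op (diag_mx b) 1%:M (- A) Q) S) :
  defect S = +oo%E.
Proof.
have A_unit : A \in unitmx by rewrite unitmxE unitfE.
have AB : A *m diag_mx b = - (diag_mx b *m A).
  by apply/eqP; rewrite -addr_eq0 AB_anticomm.
have S_sym s : S s -> end_symmetric A eps s.
  case: S_root => E [basisE ->] [lambda lambda_eig Es].
  have [EV _ _] := basisE lambda lambda_eig.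
  exact: (root_end_symmetric B_unit A_unit AB Q_L1 (ltW eps_gt0) eps_le1 Q_sym
    (EV _ Es)).
have span_sym g : lin_span S g -> in_Lp 2 g /\ end_symmetric A eps g.
  move=> [gL2 [k [s [c [Ss gs]]]]]; split => //.
  apply: (end_symmetric_aeq eps_le1 gs).
  by apply: end_symmetric_sum => i; exact: S_sym.
apply/eqyP => r r0; set k := (Num.truncn r).+1.
apply: (@le_trans _ _ k%:R%:E).
  by rewrite lee_fin ltW// truncnS_gt.
apply: ereal_sup_ubound; exists k => //=.
pose v : 'cV[R[i]]_n := delta_mx (Ordinal n_gt0) 0.
have v0 : v != 0.
  apply/eqP => /matrixP /(_ (Ordinal n_gt0) 0) /eqP.
  by rewrite !mxE !eqxx oner_eq0.
(* Staying below 1/2 keeps the k intervals disjoint from their mirror images. *)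
pose d := Num.min eps 2^-1.
have d0 : 0 < d by rewrite lt_min eps_gt0 invr_gt0 ltr0n.
have d_eps : d <= eps by rewrite ge_min lexx.
have d_half : d <= 2^-1 by rewrite ge_min lexx orbT.
pose s := d / k%:R.
have s0 : 0 < s by rewrite divr_gt0// ltr0n.
pose I (i : 'I_k) : set (measurableTypeR R) :=
  `] (i%:R * s), (i.+1%:R * s) [%classic.
have I_d i : I i `<=` `[0, d[.
  move=> x; rewrite /I /= !in_itv /= => /andP[ix xi].
  have is0 : 0 <= i%:R * s by apply: mulr_ge0; [exact: ler0n|exact: ltW].
  have sd : i.+1%:R * s <= d.
    rewrite /s mulrCA ler_piMr ?(ltW d0)//.
    by rewrite ler_pdivrMr ?ltr0n// mul1r ler_nat.
  by rewrite (le_trans is0 (ltW ix)) (lt_le_trans xi sd).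
have mI i : measurable (I i) by exact: measurable_itv.
exists (fun i => antisymmetric_bump A (I i) v); split.
  move=> i; split; first exact: antisymmetric_bump_in_L2.
  move=> g /span_sym[gL2 gsym].
  apply: antisymmetric_bump_orthogonal gL2 gsym => // x /I_d.
  by rewrite /= !in_itv /= => /andP[-> xd]; rewrite ltW// (lt_le_trans xd).
apply: antisymmetric_bump_lin_indep => //.
- move=> i; rewrite lebesgue_measure_itv /= lte_fin ltr_pM2r// ltr_nat ltnSn.
  by rewrite -EFinB lte_fin -mulrBl -natrB// subSnn mul1r.
- move=> i x /I_d; rewrite /= !in_itv /= => /andP[-> xd].
  exact: lt_le_trans xd _.
move=> i j _ _ [x []]; rewrite /I /= !in_itv /= => /andP[ix xi] /andP[jx xj].
have lt1 := lt_trans ix xj; have lt2 := lt_trans jx xi.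
rewrite (ltr_pM2r s0) ltr_nat ltnS in lt1.
rewrite (ltr_pM2r s0) ltr_nat ltnS in lt2.
by apply: val_inj; apply: anti_leq; rewrite lt1 lt2.
Qed.
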